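(* Let $T$ be a tree. Then $$\gamma_{\rm MB}(T)=\begin{cases}\frac{n(T)}{2}, & T \text{ has a perfect matching},\\ \frac{n(T)-1}{2}, & R(T)\cong K_1,\\ \frac{n(T)-k+1}{2}, & R(T)\cong K_{1,k}\text{ for some } k\ge 3,\\ \infty, & \text{otherwise},\end{cases}$$ and $$\gamma_{\rm MB}'(T)=\begin{cases}\frac{n(T)}{2}, & T \text{ has a perfect matching},\\ \infty, & \text{otherwise}.\end{cases}$$
   Context: $n(T)$ is the number of vertices of $T$. A pendant $P_2$ in a graph is a path $xy$ attached to the rest of the graph by a single edge, i.e. $x$ has degree $1$, its unique neighbor $y$ has degree $2$, and $y$ has exactly one other neighbor; removing it deletes $x$ and $y$. If the current graph is itself $P_2$, it may also be removed, leaving the empty graph. The residual graph $R(T)$ is obtained from $T$ by iteratively removing pendant $P_2$'s until none is present. The Maker-Breaker domination game on a graph: Dominator and Staller alternately select a vertex not selected before; Dominator wins if at some point his selected vertices form a dominating set, Staller wins otherwise. In the D-game Dominator moves first, in the S-game Staller moves first. $\gamma_{\rm MB}(T)$ (resp. $\gamma_{\rm MB}'(T)$) is the minimum $k$ such that Dominator has a strategy in the D-game (resp. S-game) guaranteeing that his selected vertices dominate the graph after at most $k$ of his moves, whatever Staller does, and is $\infty$ if he has no winning strategy.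
   Formalization: The case R(T) ≅ K_1 of the D-game formula is stated only for n(T) > 1, since for T = K_1 the printed formula gives 0 while Dominator needs one move, so γ_MB(K_1) = 1. *)

(* Defs.v *)
From HB Require Import structures.
From mathcomp Require Import all_boot all_order all_algebra.
From mathcomp Require Import boolp constructive_ereal.

Set Implicit Arguments.
Unset Strict Implicit.
Unset Printing Implicit Defensive.

Import Order.TTheory GRing.Theory Num.Theory.

Record sgraph := SGraph {
  vertex :> finType;
  adj : rel vertex;
  adj_sym : symmetric adj;
  adj_irr : irreflexive adj }.

Definition iso (G H : sgraph) : Prop :=
  exists2 f : G -> H, bijective f & forall x y, adj (f x) (f y) = adj x y.

Section Induced.
Variables (G : sgraph) (S : {set G}).

Definition induced_rel : rel {x : G | x \in S} :=
  fun u v => adj (val u) (val v).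

Lemma induced_sym : symmetric induced_rel.
Proof. by move=> u v; apply: adj_sym. Qed.

Lemma induced_irr : irreflexive induced_rel.
Proof. by move=> u; apply: adj_irr. Qed.

Definition induced : sgraph := SGraph induced_sym induced_irr.
End Induced.

Section Complete.
Variable n : nat.

Definition complete_rel : rel 'I_n := fun i j => i != j.

Lemma complete_sym : symmetric complete_rel.
Proof. by move=> i j; rewrite /complete_rel eq_sym. Qed.

Lemma complete_irr : irreflexive complete_rel.
Proof. by move=> i; rewrite /complete_rel eqxx. Qed.

Definition complete : sgraph := SGraph complete_sym complete_irr.
End Complete.

Section CompleteBipartite.
Variables m n : nat.

Definition bipartite_rel : rel ('I_m + 'I_n) :=
  fun u v => match u, v with
             | inl _, inr _ | inr _, inl _ => true
             | _, _ => false
             end.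

Lemma bipartite_sym : symmetric bipartite_rel.
Proof. by move=> [i|i] [j|j]. Qed.

Lemma bipartite_irr : irreflexive bipartite_rel.
Proof. by move=> [i|i]. Qed.

Definition complete_bipartite : sgraph := SGraph bipartite_sym bipartite_irr.
End CompleteBipartite.

(* As [adj] is symmetric, every edge xy yields the closed walk [:: x; y];
   genuine cycles are those with at least three vertices. *)
Definition acyclic (G : sgraph) : Prop :=
  forall c : seq G, ucycle (@adj G) c -> size c <= 2.

Definition tree (G : sgraph) : Prop :=
  [/\ 0 < #|G|, forall x y : G, connect (@adj G) x y & acyclic G].

Definition perfect_matching (G : sgraph) (M : {set {set G}}) : Prop :=
  partition M [set: G] /\
  forall B, B \in M -> exists2 p : G * G, adj p.1 p.2 & B = [set p.1; p.2].

Definition has_perfect_matching (G : sgraph) : Prop :=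
  exists M : {set {set G}}, perfect_matching M.

(* The current graph of the reduction is the subgraph of G induced by S. *)
Section Residual.
Variable G : sgraph.

Definition degree_in (S : {set G}) (x : G) : nat := #|[set z in S | adj x z]|.

Definition pendantP2 (S : {set G}) (x y : G) : bool :=
  [&& x \in S, y \in S, adj x y &
      (degree_in S x == 1) && (degree_in S y == 2) || (S == [set x; y])].

Inductive reduces_to : {set G} -> Prop :=
| reduces_start : reduces_to [set: G]
| reduces_step S x y :
    reduces_to S -> pendantP2 S x y -> reduces_to (S :\: [set x; y]).

Definition residual (S : {set G}) : Prop :=
  reduces_to S /\ forall x y, ~~ pendantP2 S x y.

Lemma residual_exists : exists S, residual S.
Proof.
suff H n (S : {set G}) : #|S| <= n -> reduces_to S -> exists S', residual S'.
  exact: (H #|[set: G]| _ (leqnn _) reduces_start).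
elim: n S => [|n IHn] S leSn redS.
  exists S; split=> // x y; apply/negP => /and4P[xS _ _ _].
  by move: leSn; rewrite leqn0 cards_eq0 => /eqP S0; rewrite S0 inE in xS.
have [/existsP[x /existsP[y xyS]]|none] :=
  boolP [exists x, [exists y, pendantP2 S x y]].
  apply: (IHn (S :\: [set x; y])); last exact: reduces_step.
  have /and4P[xS _ _ _] := xyS.
  rewrite -ltnS; apply: leq_trans leSn; apply/proper_card/properP.
  by split; [apply: subsetDl | exists x; rewrite // !inE eqxx].
exists S; split=> // x y; apply: contra none => xyS.
by apply/existsP; exists x; apply/existsP; exists y.
Qed.
End Residual.

(* Maker-Breaker domination game.  A history is the sequence of all vertices
   selected so far, in chronological order; the boolean [b] tells whether
   Dominator makes the first move ([true]: D-game, [false]: S-game). *)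
Section Game.
Variables (G : sgraph) (b : bool).

Definition dominating (D : {set G}) : bool :=
  [forall v, (v \in D) || [exists u in D, adj u v]].

Definition dominator_turn (h : seq G) : bool := odd (size h) (+) b.

Fixpoint dominator_moves_from (t : bool) (h : seq G) : seq G :=
  if h is x :: h' then
    if t then x :: dominator_moves_from (~~ t) h'
    else dominator_moves_from (~~ t) h'
  else [::].

Definition dominator_moves : seq G -> seq G := dominator_moves_from b.

Definition follows (sigma : seq G -> G) (h : seq G) : Prop :=
  forall p x, prefix (rcons p x) h -> dominator_turn p -> x = sigma p.

Definition legal_strategy (sigma : seq G -> G) : Prop :=
  forall h, uniq h -> size h < #|G| -> follows sigma h -> dominator_turn h ->
    sigma h \notin h.

(* Plays are continued until all vertices are selected, also after Dominator
   has won; this is harmless, since only his first k moves are examined and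
   supersets of dominating sets are dominating. *)
Definition wins_within (k : nat) : Prop :=
  exists2 sigma : seq G -> G, legal_strategy sigma &
    forall h, uniq h -> size h = #|G| -> follows sigma h ->
      dominating [set x in take k (dominator_moves h)].

Lemma wins_within_asbool :
  (exists k, wins_within k) -> exists k, `[< wins_within k >].
Proof. by case=> k wk; exists k; apply/asboolP. Qed.

Definition MB_number : \bar rat :=
  match pselect (exists k, wins_within k) with
  | left ex => ((ex_minn (wins_within_asbool ex))%:R)%:E%E
  | right _ => +oo%E
  end.
End Game.

Definition gamma_MB (G : sgraph) : \bar rat := MB_number G true.
Definition gamma_MB' (G : sgraph) : \bar rat := MB_number G false.

(* Main.v *)
(* If Dominator opens with [v], then he wins if and only if, for some set [Z] of
   neighbours of [v], the graph [T - v - Z] has a perfect matching.  Given such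
   a matching, he answers inside its edges.  Conversely, root the tree at [v]
   and let [x] be a deepest vertex outside [N[v]]: if [x] has a sibling,
   Staller claims the common parent and gets a double threat; otherwise she
   claims the parent, which forces Dominator to take [x], where he dominates
   nothing that is left, and the pair is removed.  This makes the number of
   moves exactly [1 + (n - 1 - |Z|) / 2].  The S-game is the same without [v]
   and [Z].

   For [|Z| >= 3], the existence of such a star with a matchable complement is
   invariant under the removal of a pendant P_2, and so are the existence of a
   perfect matching and of a near-perfect one ([Z] empty).  In a tree without
   pendant P_2 a star with a matchable complement is everything, since a deepest
   matching edge outside the star would be a pendant P_2.  Finally, [|Z| = 1]
   means that [T] has a perfect matching, and [|Z| = 2] reduces to [Z] empty by
   matching [v] with one of its two neighbours. *)

Require Import Defs.
From HB Require Import structures.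
From mathcomp Require Import all_boot all_order all_algebra.
From mathcomp Require Import boolp constructive_ereal.

Set Implicit Arguments.
Unset Strict Implicit.
Unset Printing Implicit Defensive.

Import Order.TTheory GRing.Theory Num.Theory.

(** * Rooted trees: depth and parent *)

Section RootedTree.
Variables (T : sgraph) (treeT : tree T).

Definition avoid (w : T) : rel T := fun x y => [&& adj x y, x != w & y != w].

Lemma avoid_connect_sym w : connect_sym (avoid w).
Proof.
by apply: sym_connect_sym => x y; rewrite /avoid /= adj_sym [(x != w) && _]andbC.
Qed.

Lemma sub_path_avoid w a q :
  path (@adj T) a q -> w \notin a :: q -> path (avoid w) a q.
Proof.
elim: q a => //= b q IHq a /andP[ab pq]; rewrite !inE !negb_or.
case/and3P=> wa wb wq; rewrite /avoid ab /= ![_ == w]eq_sym wa wb /=.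
by apply: IHq; rewrite ?inE ?negb_or ?wb.
Qed.

(* Two distinct neighbours of [w] joined outside [w] would close a cycle. *)
Lemma avoid_neighbor_uniq w a b :
  adj w a -> adj w b -> connect (avoid w) a b -> a = b.
Proof.
move=> wa wb /connectP[p pp eb].
move: wb; rewrite {}eb; case: (shortenP pp) => p' pp' up' _ wb.
case: p' pp' up' wb => [//|c p'] pp' up' wb.
have [_ _ acT] := treeT.
suff /acT : ucycle (@adj T) [:: w, a, c & p'] by [].
have wq : w \notin [:: a, c & p'].
  apply/negP => wq.
  have /path_connect/(_ _ wq) := pp'.
  rewrite avoid_connect_sym; case/connectP=> [[|e r]] /=.
    by move=> _ eaw; rewrite eaw adj_irr in wa.
  by rewrite /avoid eqxx andbF.
rewrite /ucycle cons_uniq wq up' andbT [cycle _ _]/= rcons_path.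
rewrite wa [adj (last _ _) w]adj_sym wb.
rewrite /= !andbT; apply: (sub_path (e' := @adj T) _ pp').
by move=> x y /and3P[].
Qed.

Section Root.
Variable r : T.

Lemma root_path_ex w : exists n,
  `[< exists p, [/\ path (@adj T) w p, last w p = r & size p = n] >].
Proof.
have [_ cT _] := treeT; have /connectP[p pp lp] := cT w r.
by exists (size p); apply/asboolP; exists p.
Qed.

Definition depth w := ex_minn (root_path_ex w).

(** The choice is unique by [avoid_neighbor_uniq]. At the root no neighbour qualifies, since no step
    of [avoid r] enters [r], so the default makes the root its own parent. *)
Definition parent w := odflt w [pick a | adj w a && connect (avoid w) a r].

Lemma depth_min w p : path (@adj T) w p -> last w p = r -> depth w <= size p.
Proof.
move=> pp lp; rewrite /depth; case: ex_minnP => m _; apply.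
by apply/asboolP; exists p.
Qed.

Lemma depth_path w : exists p,
  [/\ path (@adj T) w p, last w p = r, size p = depth w & uniq (w :: p)].
Proof.
rewrite /depth; case: ex_minnP => m /asboolP[p [pp lp sp]] min.
move: lp; case: (shortenP pp) => p' pp' up' sub lp.
have szp' : size p' <= size p.
  by apply: uniq_leq_size; [case/andP: up' | apply: sub].
exists p'; split=> //; apply/eqP; rewrite eqn_leq -{1}sp szp' /=.
by apply: min; apply/asboolP; exists p'.
Qed.

Lemma depth_adj u w : adj u w -> depth u <= (depth w).+1.
Proof.
move=> uw; have [p [pp lp <- _]] := depth_path w.
by apply: (@depth_min u (w :: p)); rewrite //= uw.
Qed.

Lemma parent_eq w a : adj w a -> connect (avoid w) a r -> parent w = a.
Proof.
move=> wa war; rewrite /parent; case: pickP => [b /andP[wb wbr]|/(_ a)] /=.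
  apply: (avoid_neighbor_uniq wb wa); apply: connect_trans wbr _.
  by rewrite avoid_connect_sym.
by rewrite wa war.
Qed.

Lemma root_path_avoid w a q : path (@adj T) a q -> last a q = r ->
  w \notin a :: q -> connect (avoid w) a r.
Proof.
by move=> pq lq wq; apply/connectP; exists q; rewrite ?(sub_path_avoid pq wq).
Qed.

Lemma parentP w : w != r -> adj w (parent w) /\ depth w = (depth (parent w)).+1.
Proof.
move=> wr; have [[|a q] [/= pp lp sp up]] := depth_path w.
  by rewrite lp eqxx in wr.
case/andP: pp => wa pq; case/andP: up => wq _.
rewrite (parent_eq wa (root_path_avoid pq lp wq)); split=> //.
by apply/eqP; rewrite eqn_leq depth_adj //= -sp ltnS depth_min.
Qed.

Lemma parent_adj w : w != r -> adj w (parent w).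
Proof. by case/parentP. Qed.

Lemma depth_parent w : w != r -> depth w = (depth (parent w)).+1.
Proof. by case/parentP. Qed.

(** If [w] reaches the root outside [u], then [w] is the parent of [u]. Otherwise a shortest root
    path of [u] misses [w], which makes [u] the parent of [w]. *)
Lemma adj_parent u w : adj u w ->
  (u != r) && (parent u == w) || (w != r) && (parent w == u).
Proof.
move=> uw; have [ur|ur] := eqVneq u r => /=.
  rewrite -ur in uw *; have [wu|wu] := eqVneq w u.
    by rewrite wu adj_irr in uw.
  by apply/eqP/parent_eq; rewrite ?ur ?connect0 // -ur adj_sym.
have [war|Nwar] := boolP (connect (avoid u) w r).
  by rewrite (parent_eq uw war) eqxx.
apply/orP; right.
have [[|a q] [/= pp lp sp up]] := depth_path u; first by rewrite lp eqxx in ur.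
case/andP: (pp) => ua pq; case/andP: up => uq _.
have waq : w \notin a :: q.
  apply: contra Nwar => waq.
  have /path_connect/(_ _ waq) := sub_path_avoid pq uq.
  rewrite avoid_connect_sym => /connect_trans; apply.
  exact: root_path_avoid pq lp uq.
have -> /= : w != r.
  by apply: contraNneq waq => ->; rewrite -lp mem_last.
apply/eqP/parent_eq; first by rewrite adj_sym.
apply: (@root_path_avoid _ _ (a :: q)) => //.
rewrite inE negb_or waq andbT; apply: contraTneq uw => ->.
by rewrite adj_irr.
Qed.

Lemma parent_neq u : u != r -> parent u != r -> parent (parent u) != u.
Proof.
move=> ur pr; apply/eqP => ppu; have := depth_parent pr.
rewrite ppu (depth_parent ur) => /eqP.
by rewrite -[X in X == _]addn0 -addn2 eqn_add2l.
Qed.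

End Root.

(** This is connectedness of the induced subgraph: the tree path from [u] to [r] stays in [S].
    Quantifying over all roots lets the root be chosen after the reduction. *)
Definition convex (S : {set T}) :=
  forall r u, r \in S -> u \in S -> u != r -> parent r u \in S.

Lemma convexT : convex [set: T].
Proof. by move=> r u *; rewrite inE. Qed.

End RootedTree.

(** * Matchings as involutions *)

Section Matching.
Variable T : sgraph.
Implicit Types (A B S D F Z : {set T}) (f : T -> T).

(** The partner map of a perfect matching of the subgraph induced by [A]. Values outside [A] are
    free, so the same [f] still serves after pairs are deleted. *)
Definition matched A f :=
  forall u, u \in A -> [/\ f u \in A, adj u (f u) & f (f u) = u].

Definition matchable A := exists f, matched A f.

Lemma matchable0 : matchable set0.
Proof. by exists id => u; rewrite inE. Qed.

Lemma adj_neq (x y : T) : adj x y -> x != y.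
Proof. by apply: contraTneq => ->; rewrite adj_irr. Qed.

Lemma card_pairD B x y : x \in B -> y \in B -> x != y ->
  #|B| = #|B :\: [set x; y]|.+2.
Proof.
move=> xB yB xy; rewrite -(cardsID [set x; y] B).
suff -> : B :&: [set x; y] = [set x; y] by rewrite cards2 xy.
by apply/setIidPr/subsetP => z; rewrite !inE => /orP[] /eqP ->.
Qed.

Lemma matchable_add B x y : adj x y -> x \in B -> y \in B ->
  matchable (B :\: [set x; y]) -> matchable B.
Proof.
move=> xy xB yB [f mf]; have nxy := adj_neq xy.
exists (fun u => if u == x then y else if u == y then x else f u) => u uB.
have [->|ux] := eqVneq u x; first by rewrite eq_sym (negPf nxy) eqxx.
have [->|uy] := eqVneq u y; first by rewrite eqxx adj_sym.
have [|fB afu ffu] := mf u; first by rewrite !inE negb_or ux uy.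
move: fB; rewrite !inE negb_or => /andP[/andP[fx fy] fB].
by rewrite (negPf fx) (negPf fy).
Qed.

Lemma matched_del B f x : matched B f -> x \in B ->
  matched (B :\: [set x; f x]) f.
Proof.
move=> mf xB u; rewrite !inE negb_or => /andP[/andP[ux ufx] uB].
have [fuB afu ffu] := mf u uB; rewrite fuB afu ffu negb_or !andbT; split=> //.
apply/andP; split; apply/eqP => e.
  by rewrite -e ffu eqxx in ufx.
by have [_ _ ffx] := mf x xB; rewrite -ffu e ffx eqxx in ux.
Qed.

Lemma matchable_even B : matchable B -> exists m, #|B| = m.*2.
Proof.
case=> f; have [n] := ubnP #|B|; elim: n B => // n IHn B ltB mf.
have [->|[x xB]] := set_0Vmem B; first by exists 0; rewrite cards0.
have [fxB xfx _] := mf x xB.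
have cB := card_pairD xB fxB (adj_neq xfx).
case: (IHn (B :\: [set x; f x])) => [||m cm].
- by rewrite cB in ltB; rewrite -ltnS ltnW.
- exact: matched_del.
by exists m.+1; rewrite cB cm doubleS.
Qed.

Lemma perfect_matchingP : has_perfect_matching T <-> matchable [set: T].
Proof.
split=> [[M [/and3P[/eqP cM tM _] edgeM]]|[f mf]].
  pose f u := odflt u [pick w in pblock M u | w != u].
  have fE u : exists w, [/\ f u = w, adj u w & pblock M u = [set u; w]].
    have uM : u \in cover M by rewrite cM inE.
    have [[p q] /= pq eB] := edgeM _ (pblock_mem uM).
    have npq := adj_neq pq.
    have : u \in pblock M u by rewrite mem_pblock.
    rewrite /f; case: pickP => [w|none] /=; rewrite eB !inE.
      case/andP=> /orP[]/eqP -> nu /orP[]/eqP eu; rewrite eu ?eqxx // in nu *.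
        by exists p; rewrite adj_sym setUC.
      by exists q.
    move=> upq; have := none p; have := none q; rewrite eB !inE !eqxx orbT /=.
    move=> /negbFE/eqP qu /negbFE/eqP pu; move: npq.
    by rewrite pu qu eqxx.
  exists f => u _; have [w [-> uw eB]] := fE u; split; rewrite ?inE //.
  have [v [-> wv eBw]] := fE w.
  have : pblock M w = pblock M u.
    by apply: same_pblock; rewrite // eB !inE eqxx orbT.
  rewrite eB eBw => /setP/(_ u); rewrite !inE eqxx /= => /orP[|]/eqP //.
  by move=> e; rewrite e adj_irr in uw.
exists [set [set u; f u] | u : T]; split; last first.
  by move=> _ /imsetP[u _ ->]; exists (u, f u); case: (mf u (in_setT u)).
apply/and3P; split.
- rewrite eqEsubset subsetT; apply/subsetP => u _; apply/bigcupP.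
  by exists [set u; f u]; [apply: imset_f | rewrite !inE eqxx].
- apply/trivIsetP => _ _ /imsetP[u _ ->] /imsetP[w _ ->] neq.
  rewrite -setI_eq0; apply: contraNT neq => /set0Pn[z].
  have [_ _ ffu] := mf u (in_setT u); have [_ _ ffw] := mf w (in_setT w).
  have E t : f (f t) = t -> z \in [set t; f t] -> [set t; f t] = [set z; f z].
    by move=> fft; rewrite !inE => /orP[]/eqP -> //; rewrite fft setUC.
  by rewrite inE => /andP[/(E _ ffu)-> /(E _ ffw)->].
- apply/imsetP => -[u _ /setP/(_ u)].
  by rewrite !inE eqxx.
Qed.

End Matching.

(** * Game positions and the pairing strategy *)

Section Positions.
Variable G : sgraph.
Implicit Types (D F A : {set G}) (t : bool) (k n : nat).

Fixpoint win_fuel n t k D F : bool :=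
  dominating D ||
  if n is n'.+1 then
    if t then (0 < k) && [exists x in F, win_fuel n' false k.-1 (x |: D) (F :\ x)]
    else [forall x in F, win_fuel n' true k D (F :\ x)]
  else false.

(* Dominator, who owns [D], can dominate with at most [k] further moves when
   [F] is the set of free vertices and [t] tells whether he is to move; the
   vertices outside [D :|: F] belong to Staller. *)
Definition win t k D F := win_fuel #|F| t k D F.

(** The recursion with the fuel hidden: every move removes exactly one free vertex. *)
Lemma winE t k D F : win t k D F = dominating D || (F != set0) &&
  (if t then (0 < k) && [exists x in F, win false k.-1 (x |: D) (F :\ x)]
   else [forall x in F, win true k D (F :\ x)]).
Proof.
have [->|F0] := eqVneq F set0; first by rewrite /win cards0 /=.
have cF x : x \in F -> #|F| = #|F :\ x|.+1 by move=> xF; rewrite (cardsD1 x) xF.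
rewrite /win; move/set0Pn: F0 => [x0 x0F]; rewrite {1}(cF _ x0F) /=.
congr (_ || _); case: t.
  congr (_ && _); apply: eq_existsb => x; case: (boolP (x \in F)) => // xF.
  by rewrite -(eq_add_S _ _ (etrans (esym (cF _ x0F)) (cF _ xF))).
apply: eq_forallb => x; case: (boolP (x \in F)) => // xF.
by rewrite -(eq_add_S _ _ (etrans (esym (cF _ x0F)) (cF _ xF))).
Qed.

Lemma dominatingP D : reflect
  (forall v, v \in D \/ exists2 u, u \in D & adj v u) (dominating D).
Proof.
apply: (iffP forallP) => H v; have := H v.
  by case/orP=> [|/exists_inP[u uD uv]]; [left|right; exists u; rewrite // adj_sym].
case=> [->//|[u uD vu]]; apply/orP; right; apply/exists_inP; exists u => //.
by rewrite adj_sym.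
Qed.

(** [D :|: F] never grows during play, so Dominator never gets a vertex of the closed neighbourhood
    of [x]. *)
Lemma lost_vertex x t k D F : x \notin D :|: F ->
  (forall w, adj x w -> w \notin D :|: F) -> win t k D F = false.
Proof.
have [n] := ubnP #|F|; elim: n t k D F => // n IHn t k D F ltF xDF nx.
apply/negbTE; rewrite winE negb_or; apply/andP; split.
  apply/negP => /dominatingP/(_ x)[xD|[u uD xu]].
    by rewrite inE xD in xDF.
  by have := nx u xu; rewrite inE uD.
apply/negP => /andP[/set0Pn[x0 x0F]].
have ltF' y : y \in F -> #|F :\ y| < n.
  by move=> yF; move: ltF; rewrite (cardsD1 y) yF.
case: t => [/andP[_ /exists_inP[y yF]]|/forall_inP/(_ _ x0F)].
  have sub w : w \notin D :|: F -> w \notin (y |: D) :|: (F :\ y).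
    apply: contra; rewrite !inE => /orP[/orP[/eqP->|->]|/andP[_ ->]];
    by rewrite ?yF ?orbT.
  by rewrite IHn ?ltF' ?sub // => w /nx/sub.
have sub w : w \notin D :|: F -> w \notin D :|: (F :\ x0).
  by apply: contra; rewrite !inE => /orP[->|/andP[_ ->]]; rewrite ?orbT.
by rewrite IHn ?ltF' ?sub // => w /nx/sub.
Qed.

Lemma undominated x D F : [disjoint D & F] -> x \in F ->
  (forall w, adj x w -> w \in D -> False) -> dominating D = false.
Proof.
move=> dDF xF nx; apply/negbTE/negP => /dominatingP/(_ x)[xD|[u uD xu]].
  by rewrite (disjointFr dDF xD) in xF.
exact: nx xu uD.
Qed.

Lemma isolated_vertex x k D F : [disjoint D & F] -> x \in F ->
  (forall w, adj x w -> w \notin D :|: F) -> win false k D F = false.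
Proof.
move=> dDF xF nx; rewrite winE (undominated dDF xF) /=; last first.
  by move=> w /nx; rewrite inE negb_or => /andP[/negP].
apply/negbTE/negP => /andP[_ /forall_inP/(_ _ xF)].
rewrite (@lost_vertex x) //.
  by rewrite !inE eqxx (disjointFl dDF xF).
by move=> w /nx; apply: contra; rewrite !inE => /orP[->|/andP[_ ->]]; rewrite ?orbT.
Qed.

Lemma disjoint_move D F x y : [disjoint D & F] ->
  [disjoint x |: D & F :\ y :\ x].
Proof.
move=> dDF; rewrite -setI_eq0; apply/eqP/setP => w; rewrite !inE.
case: (eqVneq w x) => //= _; case: (boolP (w \in D)) => //= wD.
by rewrite (disjointFr dDF wD) andbF.
Qed.

(* Staller takes [y], threatening [x]; Dominator has no choice but [x]. *)
Lemma forced_pair x y k D F : [disjoint D & F] -> x \in F -> y \in F -> x != y ->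
  (forall w, adj x w -> w \in D :|: F -> w = y) -> win false k D F ->
  0 < k /\ win false k.-1 (x |: D) (F :\ y :\ x).
Proof.
move=> dDF xF yF xy nx.
have yD : y \in D = false by rewrite (disjointFl dDF yF).
have xD : x \in D = false by rewrite (disjointFl dDF xF).
have ND : dominating D = false.
  apply: (undominated dDF xF) => w xw wD.
  by rewrite -(nx w xw) ?wD // inE wD in yD.
rewrite winE ND => /andP[_ /forall_inP/(_ _ yF)].
rewrite winE ND => /andP[_ /andP[k0 /exists_inP[w]]].
rewrite !inE => /andP[wy wF].
have [->|wx] := eqVneq w x => // winw; split=> //; move: winw.
rewrite (@isolated_vertex x) //.
- exact: disjoint_move.
- by rewrite !inE eq_sym wx xy xF.
move=> u xu; apply/negP => uDF; have uy : u = y.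
  apply: nx => //; move: uDF; rewrite !inE => /orP[/orP[/eqP->|->]|/and3P[_ _ ->]];
  by rewrite ?wF ?orbT.
by move: uDF; rewrite uy !inE eqxx yD eq_sym (negPf wy) andbF.
Qed.

(** The invariant is that [D] dominates everything outside [A]. Each move of Dominator takes one end
    of a pair and thereby dominates both ends, so the pair leaves [A], and half of [#|A|] moves
    suffice. *)
Lemma pairing_win A f t k D F : matched A f -> A \subset F ->
  (forall u, u \notin A -> u \in D \/ exists2 w, w \in D & adj u w) ->
  #|A| <= k.*2 -> win t k D F.
Proof.
have [n] := ubnP #|A|; elim: n A t k D F => // n IHn A t k D F ltA mf sAF dom leA.
have [A0|[a0 a0A]] := set_0Vmem A.
  rewrite winE; apply/orP; left; apply/dominatingP => v; apply: dom.
  by rewrite A0 inE.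
(* Here [F'] is the free set when Dominator is to move; [f a] may already belong to Staller. *)
have reply a F' : a \in A -> a \in F' ->
    A :\: [set a; f a] \subset F' -> win true k D F'.
  move=> aA aF' sAF'; have [faA afa ffa] := mf a aA.
  have cA := card_pairD aA faA (adj_neq afa).
  have k0 : 0 < k by move: leA; rewrite cA; case: (k).
  rewrite winE; apply/orP; right; apply/andP; split.
    by apply/set0Pn; exists a.
  rewrite k0 /=; apply/exists_inP; exists a => //.
  apply: (IHn (A :\: [set a; f a])).
  - by move: ltA; rewrite cA ltnS => /ltnW.
  - exact: matched_del.
  - apply/subsetP => u uA'; have := subsetP sAF' u uA'.
    by move: uA'; rewrite !inE negb_or => /andP[/andP[-> _] _].
  - move=> u; rewrite inE negb_and negbK => /orP[|/dom[uD|[w wD uw]]].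
    + rewrite !inE => /orP[]/eqP ->; first by left; rewrite eqxx.
      by right; exists a; rewrite ?inE ?eqxx // adj_sym.
    + by left; rewrite inE uD orbT.
    + by right; exists w; rewrite // inE wD orbT.
  - by move: leA; rewrite cA -(prednK k0) doubleS !ltnS.
case: t.
  apply: (reply a0) => //; first exact: (subsetP sAF).
  by apply: subset_trans sAF; apply: subsetDl.
rewrite winE; apply/orP; right; apply/andP; split.
  by apply/set0Pn; exists a0; apply: (subsetP sAF).
apply/forall_inP => x xF; have [xA|xA] := boolP (x \in A).
  have [fxA xfx ffx] := mf x xA; apply: (reply (f x)) => //.
    by rewrite !inE (subsetP sAF) // andbT eq_sym adj_neq.
  apply/subsetP => u; rewrite ffx !inE negb_or => /andP[/andP[_ ->] uA].
  exact: (subsetP sAF).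
(* Staller moved outside [A], so any pair may be used next. *)
apply: (reply a0) => //.
  by rewrite !inE (subsetP sAF) // andbT; apply: contraNneq xA => <-.
apply/subsetP => u; rewrite !inE => /andP[_ uA].
by rewrite (subsetP sAF) // andbT; apply: contraNneq xA => <-.
Qed.

End Positions.

(** * From strategies on histories to positions and back *)

Section Histories.
Variables (G : sgraph) (b : bool).
Implicit Types (p h : seq G) (sigma : seq G -> G).

Lemma dominator_moves_rcons p x : dominator_moves b (rcons p x) =
  if dominator_turn b p then rcons (dominator_moves b p) x
  else dominator_moves b p.
Proof.
rewrite /dominator_moves /dominator_turn; elim: p b => [|y p IHp] t /=.
  by case: t.
rewrite IHp; have -> : ~~ odd (size p) (+) t = odd (size p) (+) ~~ t.
  by rewrite addbN addNb.
by case: t; case: ifP.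
Qed.

Lemma dominator_turn_rcons p x :
  dominator_turn b (rcons p x) = ~~ dominator_turn b p.
Proof. by rewrite /dominator_turn size_rcons /= addNb. Qed.

Lemma follows_rcons sigma p x : follows b sigma p ->
  (dominator_turn b p -> x = sigma p) -> follows b sigma (rcons p x).
Proof.
move=> fp xE q y /prefixP[s]; case/lastP: s => [|s z].
  by rewrite cats0 => /rcons_inj[<- <-] /xE.
rewrite -rcons_cat => /rcons_inj[e _]; apply: fp.
by rewrite e prefix_prefix.
Qed.

Definition owned p : {set G} := [set x in dominator_moves b p].
Definition free p : {set G} := ~: [set x in p].

Lemma free_rcons p x : free (rcons p x) = free p :\ x.
Proof. by apply/setP => y; rewrite !inE mem_rcons inE negb_or. Qed.

Lemma owned_rcons p x : owned (rcons p x) =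
  if dominator_turn b p then x |: owned p else owned p.
Proof.
rewrite /owned dominator_moves_rcons; case: ifP => // _.
by apply/setP => y; rewrite !inE mem_rcons inE.
Qed.

Lemma card_free p : uniq p -> #|free p| = #|G| - size p.
Proof.
move=> up; have := cardsC [set x in p]; rewrite cardsE (card_uniqP up) => <-.
by rewrite addKn.
Qed.

Lemma freeP p : uniq p -> reflect (exists x, x \notin p) (size p < #|G|).
Proof.
move=> up; rewrite -subn_gt0 -card_free //; apply: (iffP card_gt0P) => -[x].
  by rewrite !inE; exists x.
by exists x; rewrite !inE.
Qed.

(** [wins_within] speaks only of finished plays, so a partial play must be extended before it
    applies. *)
Lemma complete_play sigma p : legal_strategy b sigma -> uniq p ->
  follows b sigma p -> exists h,
  [/\ uniq h, size h = #|G|, follows b sigma h & prefix p h].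
Proof.
move=> ls; have [n] := ubnP (#|G| - size p); elim: n p => // n IHn p lt up fp.
have sp : size p <= #|G| by rewrite -(card_uniqP up) max_card.
have [e|ne] := eqVneq (size p) #|G|; first by exists p; rewrite prefix_refl.
have ltp : size p < #|G| by rewrite ltn_neqAle ne.
have [x [xp fpx]] : exists x, x \notin p /\ follows b sigma (rcons p x).
  have [t|t] := boolP (dominator_turn b p).
    by exists (sigma p); split; [apply: ls | apply: follows_rcons].
  have /(freeP up)[x xp] := ltp.
  by exists x; split=> //; apply: follows_rcons => // /(negP t).
have [||h [uh sh fh ph]] := IHn (rcons p x) _ _ fpx.
- rewrite size_rcons subnS -ltnS prednK ?subn_gt0 //.
- by rewrite rcons_uniq xp.
by exists h; split=> //; apply: prefix_trans ph; apply: prefix_rcons.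
Qed.

Lemma dominating_sub (A B : {set G}) : A \subset B -> dominating A -> dominating B.
Proof.
move=> /subsetP AB /dominatingP dA; apply/dominatingP => v.
by case: (dA v) => [/AB|[u /AB uB vu]]; [left | right; exists u].
Qed.

Lemma prefix_dominator_moves p h : prefix p h ->
  prefix (dominator_moves b p) (dominator_moves b h).
Proof.
case/prefixP=> s ->; elim/last_ind: s => [|s x IHs].
  by rewrite cats0 prefix_refl.
rewrite -rcons_cat dominator_moves_rcons; case: ifP => // _.
exact: prefix_trans IHs (prefix_rcons _ _).
Qed.

Lemma dominating_prefix k p h : prefix p h ->
  size (dominator_moves b p) <= k -> dominating (owned p) ->
  dominating [set x in take k (dominator_moves b h)].
Proof.
move=> /prefix_dominator_moves/prefixP[s ->] le; apply: dominating_sub.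
apply/subsetP => x; rewrite !inE take_cat ltnNge le /= => xp.
by case: ltngtP le => // _ _; rewrite ?mem_cat xp.
Qed.

(** Along every play that follows [sigma], the position reached is won with what remains of the [k]
    moves. *)
Lemma win_of_wins_within k : wins_within G b k -> win b k (set0 : {set G}) setT.
Proof.
case=> sigma ls wsig.
suff H p : uniq p -> follows b sigma p -> size (dominator_moves b p) <= k ->
    win (dominator_turn b p) (k - size (dominator_moves b p)) (owned p) (free p).
  have := H [::] isT; rewrite subn0; have -> : owned [::] = set0.
    by apply/setP => x; rewrite !inE.
  have -> : free [::] = setT by apply/setP => x; rewrite !inE.
  by apply=> // -[].
have [n] := ubnP #|free p|; elim: n p => // n IHn p lt up fp le.
rewrite winE; have [//|ND] /= := boolP (dominating (owned p)).
have [f0|/set0Pn[x0 x0f]] /= := eqVneq (free p) set0.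
  have sp : size p = #|G|.
    have := card_free up; rewrite f0 cards0 => /esym/eqP; rewrite subn_eq0 => gs.
    by apply/eqP; rewrite eqn_leq gs -(card_uniqP up) max_card.
  case/negP: ND; apply: dominating_sub (wsig p up sp fp).
  by apply/subsetP => x; rewrite !inE; apply: mem_take.
have sp : size p < #|G| by apply/(freeP up); exists x0; rewrite !inE in x0f.
have lt' x : x \notin p -> #|free (rcons p x)| < n.
  by move=> xp; move: lt; rewrite free_rcons (cardsD1 x) !inE xp.
case tp: (dominator_turn b p).
  have xp : sigma p \notin p by apply: ls.
  have fpx : follows b sigma (rcons p (sigma p)) by apply: follows_rcons.
  have upx : uniq (rcons p (sigma p)) by rewrite rcons_uniq xp.
  (* With all [k] moves spent and no domination, a completion of the play would contradict
     [wsig]. *)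
  have lek : size (dominator_moves b p) < k.
    rewrite ltn_neqAle le andbT; apply/eqP => e.
    have [h [uh sh fh ph]] := complete_play ls up fp.
    case/negP: ND; have := wsig h uh sh fh.
    have /prefixP[s ->] := prefix_dominator_moves ph.
    by rewrite -e take_size_cat.
  rewrite subn_gt0 lek /=; apply/exists_inP; exists (sigma p); first by rewrite !inE.
  have := IHn _ (lt' _ xp) upx fpx; rewrite dominator_turn_rcons tp.
  by rewrite owned_rcons free_rcons dominator_moves_rcons tp size_rcons subnS; apply.
apply/forall_inP => x; rewrite !inE => xp.
have := IHn (rcons p x) (lt' _ xp); rewrite dominator_turn_rcons tp.
rewrite owned_rcons free_rcons dominator_moves_rcons tp; apply=> //.
  by rewrite rcons_uniq xp.
by apply: follows_rcons => //; rewrite tp.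
Qed.

(** Dominator picks any move that keeps the position won. Where none exists, an arbitrary free
    vertex keeps [sigma] legal; [x0] is the default on full histories. *)
Lemma wins_within_of_win (x0 : G) k : win b k (set0 : {set G}) setT ->
  wins_within G b k.
Proof.
move=> w0; pose good p x := (x \notin p) &&
  win false (k - size (dominator_moves b p)).-1 (x |: owned p) (free p :\ x).
pose sigma p := if [pick x | good p x] is Some x then x
                else odflt x0 [pick x | x \notin p].
have ls : legal_strategy b sigma.
  move=> p up sp _ _; rewrite /sigma; case: pickP => [x /andP[]//|_].
  have /(freeP up)[x xp] := sp.
  by case: pickP => [//|/(_ x)]; rewrite xp.
exists sigma => // h uh sh fh.
suff H p : prefix p h -> size (dominator_moves b p) <= k ->
    win (dominator_turn b p) (k - size (dominator_moves b p)) (owned p) (free p) ->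
    dominating [set x in take k (dominator_moves b h)].
  have := H [::]; rewrite prefix0s subn0; have -> : owned [::] = set0.
    by apply/setP => x; rewrite !inE.
  by have -> : free [::] = setT; [apply/setP => x; rewrite !inE | apply].
have [n] := ubnP #|free p|; elim: n p => // n IHn p lt ph le.
have [Dp _|ND] := boolP (dominating (owned p)).
  exact: dominating_prefix ph le Dp.
rewrite winE (negPf ND) /= => /andP[/set0Pn[y yf]].
have [[|x s] eh] := prefixP ph.
  rewrite cats0 in eh; have /(freeP uh) : exists x, x \notin h.
    by exists y; rewrite eh; rewrite !inE in yf.
  by rewrite sh ltnn.
have phx : prefix (rcons p x) h by rewrite eh -cat_rcons prefix_prefix.
have xp : x \notin p.
  by move: uh; rewrite eh cat_uniq => /and3P[_ /norP[]].
have lt' : #|free (rcons p x)| < n.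
  by move: lt; rewrite free_rcons (cardsD1 x) !inE xp.
move: (IHn _ lt' phx); rewrite dominator_turn_rcons dominator_moves_rcons.
rewrite owned_rcons free_rcons; case tp: (dominator_turn b p) => IH.
  case/andP=> k0 /exists_inP[z zf wz]; apply: IH; rewrite size_rcons.
    by rewrite -subn_gt0.
  have -> : x = sigma p by apply: fh.
  rewrite subnS /sigma; case: pickP => [x' /andP[]//|/(_ z)].
  by rewrite /good wz; rewrite !inE in zf; rewrite zf.
by move/forall_inP/(_ x); rewrite !inE xp => /(_ isT); apply: IH.
Qed.

End Histories.

(** * Staller's strategy of forced pairs *)

Section Staller.
Variables (T : sgraph) (treeT : tree T) (r : T).
Implicit Types (S E D F Z : {set T}).

(* [S] is the part of a forest rooted at [r] still in play.  The vertices of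
   [E] may be dominated from outside [S]; all others have to be dominated from
   within.  A deepest vertex [x] outside [E] is a leaf of [S]: if it has a
   sibling in [S], Staller wins by claiming the common parent, and otherwise
   [x] and its parent form a forced pair. *)
Lemma staller_bound k S E D F : [disjoint D & F] -> S \subset F ->
  (forall u, u \in S -> u \notin E -> u = r \/ parent r u \in S) ->
  (forall u, u \in S -> u \in E -> parent r u \notin S) ->
  (forall u w, u \in S -> u \notin E -> adj u w -> w \in D :|: F -> w \in S) ->
  win false k D F ->
  exists Z, [/\ Z \subset E, Z \subset S, matchable (S :\: Z)
              & #|S :\: Z| <= k.*2].
Proof.
have [n] := ubnP #|S|; elim: n k S D F => // n IHn k S D F ltS dDF sSF up upE nbr.
have [sSE _|] := boolP (S \subset E).
  (* All that is left may be dominated from outside, so all of it goes into [Z]. *)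
  by exists S; rewrite setDv cards0; split=> //; apply: matchable0.
case/subsetPn=> u0 u0S u0E winF.
have u0P : u0 \in S :\: E by rewrite inE u0E.
case: (arg_maxnP (depth treeT r) u0P) => x xSE max.
have /andP[xE xS] : (x \notin E) && (x \in S) by rewrite -in_setD.
have {}max w : w \in S -> w \notin E -> depth treeT r w <= depth treeT r x.
  by move=> wS wE; apply: max; apply/setDP.
pose deepest z := [/\ z \in S, z \notin E & depth treeT r z = depth treeT r x].
(* A child in [E] would have its parent outside [S]; a child outside [E] would be deeper than
   [x]. *)
have leaf z : deepest z -> forall w, w \in S -> w != r -> parent r w <> z.
  move=> [zS zE dz] w wS wr pw; have [wE|wE] := boolP (w \in E).
    by have := upE w wS wE; rewrite pw zS.
  have := max w wS wE.
  by rewrite (depth_parent treeT wr) pw dz /= ltnn.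
have only z : deepest z -> forall w, adj z w -> w \in D :|: F -> w = parent r z.
  move=> dz w zw wDF; have [zS zE _] := dz; have wS := nbr z w zS zE zw wDF.
  case/orP: (adj_parent treeT r zw) => /andP[wr /eqP e] //.
  by have := leaf z dz w wS wr e.
have dx : deepest x by [].
have xF := subsetP sSF x xS.
(* A root without children in [S] has no neighbour in [D :|: F], so Staller would simply take it. *)
have xr : x != r.
  apply/eqP => xr; move: winF; rewrite (@isolated_vertex _ x) // => w xw.
  apply/negP => /(nbr x w xS xE xw) wS.
  case/orP: (adj_parent treeT r xw); rewrite ?xr ?eqxx // => /andP[wr /eqP e].
  by apply: (leaf x dx w wS wr); rewrite e xr.
set y := parent r x; have xy : adj x y := parent_adj treeT xr.
have nxy := adj_neq xy.
have yS : y \in S by case: (up x xS xE) => [e|//]; rewrite e eqxx in xr.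
have yF := subsetP sSF y yS.
have [k0 winF'] := forced_pair dDF xF yF nxy (only x dx) winF.
have dDF' := disjoint_move x y dDF.
(* A sibling [z] would be deepest too; with [y] in Staller's hands it is isolated, and Staller is to
   move. *)
have sib z : z \in S -> z != r -> parent r z = y -> z = x.
  move=> zS zr pz; apply/eqP/negPn/negP => zx.
  have zE : z \notin E by apply/negP => /(upE z zS); rewrite pz yS.
  have dz : deepest z by split; rewrite // (depth_parent treeT zr) pz -depth_parent.
  have zy : z != y by rewrite -pz adj_neq ?parent_adj.
  move: winF'; rewrite (@isolated_vertex _ z) //.
    by rewrite !inE zx zy (subsetP sSF).
  move=> w zw; apply/negP => wDF; have wy : w = y.
    rewrite -pz; apply: only => //; move: wDF.
    rewrite !inE => /orP[/orP[/eqP->|->]|/and3P[_ _ ->]];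
    by rewrite ?xF ?orbT.
  move: wDF; rewrite wy !inE eq_sym (negPf nxy) eqxx /= orbF.
  by rewrite (disjointFl dDF yF).
pose S' := S :\: [set x; y].
have cS : #|S| = #|S'|.+2 by apply: card_pairD.
have mem' u : u \in S' -> [/\ u != x, u != y & u \in S].
  by rewrite !inE negb_or => /andP[/andP[]].
have upS u : u \in S' -> u \notin E -> u != r -> parent r u \in S'.
  move=> /mem'[ux uy uS] uE ur; rewrite !inE negb_or.
  case: (up u uS uE) => [e|->]; first by rewrite e eqxx in ur.
  rewrite andbT; apply/andP; split; apply/eqP => e.
    exact: (leaf x dx u uS ur e).
  by rewrite (sib u uS ur e) eqxx in ux.
case: (IHn k.-1 S' (x |: D) (F :\ y :\ x)) => //.
- by move: ltS; rewrite cS ltnS => /ltnW.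
- apply/subsetP => u /mem'[ux uy uS].
  by rewrite !inE ux uy (subsetP sSF).
- by move=> u uS' uE; have [->|ur] := eqVneq u r; [left | right; apply: upS].
- move=> u /mem'[_ _ uS] uE; rewrite inE negb_and.
  by rewrite upE ?orbT.
(* Dominator now owns [x], but the only neighbour of [x] in play was [y], so [x] dominates nothing
   in [S']. *)
- move=> u w /mem'[ux uy uS] uE uw; rewrite !inE => wDF.
  have wx : w != x.
    apply: contraNneq uy => wx; apply/eqP/(only x dx); first by rewrite adj_sym -wx.
    by rewrite inE (subsetP sSF) ?orbT.
  have wy : w != y.
    apply: contraTneq wDF => ->; rewrite eq_sym (negPf nxy) eqxx andbF orbF.
    by rewrite (disjointFl dDF yF).
  rewrite negb_or wx wy /=; apply: (nbr u w) => //; rewrite inE.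
  by move: wDF; rewrite (negPf wx) wy.
move=> Z [ZE /subsetP ZS' mZ cZ]; have xZ : x \in S :\: Z.
  by rewrite inE xS andbT; apply/negP => /ZS' /mem'[]; rewrite eqxx.
have yZ : y \in S :\: Z.
  by rewrite inE yS andbT; apply/negP => /ZS' /mem'[_]; rewrite eqxx.
have eZ : S' :\: Z = (S :\: Z) :\: [set x; y] by rewrite !setDDl setUC.
rewrite eZ in mZ cZ; exists Z; split=> //.
- by apply/subsetP => z /ZS' /mem'[].
- exact: matchable_add mZ.
- by rewrite (card_pairD xZ yZ nxy) -(prednK k0) doubleS !ltnS.
Qed.

(** With [E] empty, nothing is dominated from outside, which forces [Z] to be empty. *)
Lemma sgame_lower k : wins_within T false k ->
  matchable [set: T] /\ #|T| <= k.*2.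
Proof.
move/win_of_wins_within => w.
have [||u|u|u v|Z [ZE _]] := staller_bound (S := setT) (E := set0) _ _ _ _ _ w;
  rewrite ?inE //.
- by rewrite -setI_eq0 set0I.
- by right.
by move: ZE; rewrite subset0 => /eqP ->; rewrite setD0 cardsT.
Qed.

End Staller.

(** * Bounds for both games in terms of stars with matchable complement *)

Section Stars.
Variable T : sgraph.
Implicit Types (S Z : {set T}).

(** The centre [v] stands for Dominator's opening move, and the [j] leaves in [Z] are neighbours
    that it dominates and that stay unmatched. *)
Definition star_matchable S j := exists v Z, [/\ v \in S, Z \subset S,
  {in Z, forall z, adj v z}, #|Z| = j & matchable (S :\: (v |: Z))].

Lemma card_star_matchable v Z : {in Z, forall z, adj v z} ->
  #|[set: T] :\: (v |: Z)| = #|T| - #|Z|.+1.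
Proof.
move=> vZ; have vnZ : v \notin Z by apply/negP => /vZ; rewrite adj_irr.
by rewrite -(cardsC (v |: Z)) cardsU1 vnZ setTD addKn.
Qed.

(** After the opening [v], [staller_bound] applies to the rest of the tree, with root [v] and [E]
    the neighbours of [v]. The inequality says that the [k.-1] remaining moves cover half of the
    [#|T| - 1 - j] matched vertices. *)
Lemma dgame_lower k : tree T -> wins_within T true k ->
  exists2 j, star_matchable [set: T] j & #|T|.+1 <= k.*2 + j.
Proof.
move=> treeT /win_of_wins_within; rewrite winE.
have -> : dominating (set0 : {set T}) = false.
  apply/negbTE/negP => /dominatingP; have [/card_gt0P[x _] _ _] := treeT.
  by case/(_ x) => [|[u]]; rewrite inE.
case/andP=> _ /andP[k0 /exists_inP[v _]]; rewrite setU0 => w.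
have [||u|u|u x|Z [ZE ZS mZ cZ]] := staller_bound treeT (r := v)
  (S := [set: T] :\ v) (E := [set u | adj v u]) _ _ _ _ _ w; rewrite ?inE ?andbT //.
- by rewrite disjoints1 !inE eqxx.
- move=> uv Nvu; right; apply: contraNneq Nvu => e.
  by rewrite -{1}e adj_sym parent_adj.
- move=> uv vu; have := adj_parent treeT v vu.
  by rewrite eqxx /= uv => /eqP ->; rewrite eqxx.
- by move=> _ Nvu ux _; apply: contraNneq Nvu => <-; rewrite adj_sym.
have vZ : {in Z, forall z, adj v z} by move=> z /(subsetP ZE); rewrite inE.
rewrite setDDl in mZ cZ; rewrite (card_star_matchable vZ) in cZ.
exists #|Z|; first by exists v, Z; split; rewrite ?inE ?subsetT.
by move: cZ; rewrite leq_subLR addnC -(prednK k0) /= doubleS !addSn !addnS !ltnS.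
Qed.

(** The opening at the centre takes care of the leaves; the pairing strategy does the rest in [k.-1]
    moves. *)
Lemma dgame_upper j k : star_matchable [set: T] j -> #|T|.+1 <= k.*2 + j ->
  wins_within T true k.
Proof.
move=> [v [Z [_ _ vZ <- [f mf]]]] le; apply: (wins_within_of_win v).
have leZ : #|Z|.+1 <= #|T|.
  by have := max_card (mem (v |: Z)); rewrite cardsU1 (_ : v \notin Z) //;
     apply/negP => /vZ; rewrite adj_irr.
have k0 : 0 < k by move: le; case: (k) => //; rewrite add0n => /(ltn_trans leZ);
  rewrite ltnn.
rewrite winE; apply/orP; right; apply/andP; split.
  by apply/set0Pn; exists v; rewrite inE.
rewrite k0; apply/exists_inP; exists v; rewrite ?inE // setU0.
apply: (pairing_win _ mf).
- by apply/subsetP => u; rewrite !inE negb_or => /andP[/andP[->]].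
- move=> u; rewrite !inE andbT negbK => /orP[|uZ]; first by left.
  by right; exists v; rewrite ?inE // adj_sym vZ.
rewrite (card_star_matchable vZ) leq_subLR.
by move: le; rewrite -{1}(prednK k0) doubleS !addSn ltnS addnC.
Qed.

Lemma sgame_upper k (x0 : T) : matchable [set: T] -> #|T| <= k.*2 ->
  wins_within T false k.
Proof.
move=> [f mf] le; apply: (wins_within_of_win x0); apply: (pairing_win _ mf) => //.
  by move=> u; rewrite inE.
by rewrite cardsT.
Qed.

End Stars.

(** * Pendant P_2 removal and the residual graph *)

Section Residuals.
Variables (T : sgraph) (treeT : tree T).
Implicit Types (S R C Z : {set T}).

(** A common form for both kinds of removal: [y] has at most one neighbour besides [x], and none
    when [S] is itself P_2. *)
Lemma pendantP2_neighbors S x y : pendantP2 S x y ->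
  [/\ x \in S, y \in S, adj x y,
      forall w, w \in S -> adj x w -> w = y
    & forall w w', w \in S -> w' \in S -> adj y w -> adj y w' ->
        w != x -> w' != x -> w = w'].
Proof.
case/and4P=> xS yS xy /orP[/andP[/cards1P[z dx] dy]|/eqP eS]; split=> //.
- move=> w wS xw; have : w \in [set z in S | adj x z] by rewrite inE wS.
  have : y \in [set z in S | adj x z] by rewrite inE yS.
  by rewrite dx !inE => /eqP -> /eqP ->.
- move: dy; rewrite /degree_in (cardsD1 x) !inE xS adj_sym xy eqSS.
  case/cards1P=> t dy w w' wS w'S yw yw' wx w'x.
  have : w \in [set z in S | adj y z] :\ x by rewrite !inE wx wS.
  have : w' \in [set z in S | adj y z] :\ x by rewrite !inE w'x w'S.
  by rewrite dy !inE => /eqP -> /eqP ->.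
- move=> w; rewrite eS !inE => /orP[]/eqP -> //.
  by rewrite adj_irr.
move=> w w'; rewrite eS !inE => /orP[]/eqP -> _; rewrite ?adj_irr // eqxx //.
Qed.

(** No remaining [u] has its parent in the removed pair: the only neighbour of [x] is [y], and the
    only neighbour of [y] besides [x] is the parent of [y]. *)
Lemma convex_reduced S : reduces_to S -> convex S.
Proof.
elim=> [|{}S x y _ cS pS]; first exact: convexT.
have [xS yS xy nx ny] := pendantP2_neighbors pS.
have mem z : z \in S :\: [set x; y] -> [/\ z != x, z != y & z \in S].
  by rewrite !inE negb_or => /andP[/andP[]].
move=> r u /mem[rx ry rS] /mem[ux uy uS] ur.
have pu := cS r u rS uS ur; rewrite !inE negb_or pu andbT.
have rx' : x != r by rewrite eq_sym.
have ry' : y != r by rewrite eq_sym.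
have pxy : parent r x = y by apply: nx; [apply: cS | apply: parent_adj].
apply/andP; split; apply: contraNneq uy => e.
  by apply/eqP/nx => //; rewrite adj_sym -e parent_adj.
have := ny u (parent r y) uS (cS r y rS yS ry').
rewrite adj_sym -{1}e parent_adj // parent_adj // ux => /(_ isT isT isT) H.
have pyx : parent r y != x.
  by rewrite -pxy parent_neq ?pxy // eq_sym.
by have := parent_neq treeT ur; rewrite e ry' -(H pyx) eqxx => /(_ isT).
Qed.

(* A deepest matched pair outside a subtree [C] containing the root is a
   pendant P_2. *)
Lemma residual_core R C r : residual R -> r \in C -> C \subset R ->
  (forall u, u \in C -> u != r -> parent r u \in C) ->
  matchable (R :\: C) -> R = C.
Proof.
move=> [redR resR] rC /subsetP CR clC [f mf].
have cR := convex_reduced redR; have rR := CR r rC.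
apply/eqP; rewrite eqEsubset; apply/andP; split; last exact/subsetP.
apply: contraT => /subsetPn[u0 u0R u0C].
have u0P : u0 \in R :\: C by rewrite inE u0C.
case: (arg_maxnP (depth treeT r) u0P) => x xRC max.
have rt u : u \in R :\: C -> u != r.
  by rewrite inE => /andP[uC _]; apply: contraNneq uC => ->.
have child w u : w \in R -> w != r -> parent r w = u -> u \notin C -> w \in R :\: C.
  move=> wR wr pw uC; rewrite inE wR andbT; apply: contra uC => wC.
  by rewrite -pw clC.
pose deepest u := u \in R :\: C /\ depth treeT r u = depth treeT r x.
have nochild u : deepest u -> forall w, w \in R -> w != r -> parent r w <> u.
  move=> [uRC du] w wR wr pw; have uC : u \notin C by move: uRC; rewrite inE => /andP[].
  have := max w (child w u wR wr pw uC).
  by rewrite /= (depth_parent treeT wr) pw du ltnn.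
(* A deepest vertex has no child in [R], so its partner can only be its parent. *)
have fpar u : deepest u -> f u = parent r u.
  move=> du; have [uRC _] := du; have [fRC ufu _] := mf u uRC.
  case/orP: (adj_parent treeT r ufu) => /andP[wr /eqP e] //.
  by case/setDP: fRC => fR _; case: (nochild u du (f u)).
have dx : deepest x by [].
have [yRC xy fy] := mf x xRC; rewrite (fpar x dx) in yRC xy fy.
set y := parent r x in yRC xy fy; have xr := rt x xRC; have yr := rt y yRC.
have /setDP[xR xC] := xRC; have /setDP[yR yC] := yRC.
have pyx : parent r y != x by apply: parent_neq.
case/negP: (resR x y); apply/and4P; split=> //; apply/orP; left; apply/andP; split.
  apply/cards1P; exists y; apply/setP => w; rewrite !inE.
  apply/andP/eqP => [[wR xw]|->//].
  case/orP: (adj_parent treeT r xw) => /andP[wr /eqP e] //.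
  by case: (nochild x dx w wR wr e).
rewrite /degree_in (_ : [set z in R | adj y z] = [set x; parent r y]).
  by rewrite cards2 [x == _]eq_sym pyx.
apply/setP => w; rewrite !inE; apply/andP/orP => [[wR yw]|[]/eqP ->]; last 2 first.
- by rewrite adj_sym.
- by rewrite cR // parent_adj.
case/orP: (adj_parent treeT r yw) => /andP[wr /eqP e]; first by right; rewrite e.
(* Another child [w] of [y] would be deepest as well, hence matched to [y], hence equal to [x]. *)
have wRC := child w y wR wr e yC.
have dw : deepest w.
  by split; rewrite // (depth_parent treeT wr) (depth_parent treeT xr) e.
have [_ _ fw] := mf w wRC; left.
by rewrite -fw (fpar w dw) e fy.
Qed.

Lemma matchable_pendant S x y : pendantP2 S x y ->
  matchable S <-> matchable (S :\: [set x; y]).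
Proof.
move=> /pendantP2_neighbors[xS yS xy nx _]; split=> [[f mf]|]; last first.
  exact: matchable_add.
have [fxS xfx _] := mf x xS; rewrite -(nx _ fxS xfx).
by exists f; apply: matched_del.
Qed.

Lemma star_matchable_pendant_rev j S x y : pendantP2 S x y ->
  star_matchable (S :\: [set x; y]) j -> star_matchable S j.
Proof.
move=> /pendantP2_neighbors[xS yS xy nx _] [v [Z [vS /subsetP ZS vZ cZ mZ]]].
have mem z : z \in S :\: [set x; y] -> [/\ z != x, z != y & z \in S].
  by rewrite !inE negb_or => /andP[/andP[]].
have [vx vy vS'] := mem v vS.
have notZ z : z \in [set x; y] -> z \notin v |: Z.
  rewrite !inE negb_or => /orP[]/eqP ->; rewrite eq_sym ?vx ?vy /=;
  by apply/negP => /ZS /mem[]; rewrite eqxx.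
exists v, Z; split=> //; first by apply/subsetP => z /ZS /mem[].
apply: (matchable_add xy).
- by rewrite inE xS andbT notZ // !inE eqxx.
- by rewrite inE yS andbT notZ // !inE eqxx orbT.
by rewrite setDDl setUC -setDDl.
Qed.

(** A centre with at least three neighbours is neither [x] nor [y]. Then [x] is not a leaf of the
    star, its only neighbour being [y], so [x] is matched with [y] and the pair can go. *)
Lemma star_matchable_pendant j S x y : 2 < j -> pendantP2 S x y ->
  star_matchable S j -> star_matchable (S :\: [set x; y]) j.
Proof.
move=> j2 pS; have [xS yS xy nx ny] := pendantP2_neighbors pS.
move=> [v [Z [vS /subsetP ZS vZ cZ [f mf]]]].
have notZ z : z \in Z -> z != v.
  by move=> zZ; rewrite eq_sym adj_neq ?vZ.
have vx : v != x.
  apply/eqP => vx; have : #|Z| <= #|[set y]|.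
    apply/subset_leq_card/subsetP => z zZ; rewrite inE.
    by apply/eqP/nx; rewrite ?ZS // -vx vZ.
  by rewrite cZ cards1 leqNgt (ltn_trans _ j2).
have vy : v != y.
  apply/eqP => vy; have : 1 < #|Z :\ x|.
    by move: j2; rewrite -cZ (cardsD1 x); case: (x \in Z) => //; apply: ltnW.
  case/card_gt1P=> z [z' [zZ z'Z /eqP[]]].
  move: zZ z'Z; rewrite !inE => /andP[zx zZ] /andP[z'x z'Z].
  by apply: ny; rewrite ?ZS // -vy vZ.
have xZ : x \notin Z.
  by apply/negP => xZ; rewrite (nx v) ?eqxx // adj_sym vZ in vy.
have xA : x \in S :\: (v |: Z) by rewrite !inE negb_or eq_sym vx xZ.
have [fxA xfx _] := mf x xA.
have fxy : f x = y by apply: nx; move: fxA; rewrite inE => /andP[].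
have yZ : y \notin Z by move: fxA; rewrite fxy !inE negb_or => /andP[/andP[]].
exists v, Z; split=> //.
- by rewrite !inE negb_or vx vy.
- apply/subsetP => z zZ; rewrite !inE negb_or ZS // andbT.
  by apply/andP; split; apply: contraTneq zZ => ->.
exists f; have := matched_del mf xA.
by rewrite fxy !setDDl setUC.
Qed.

Lemma star_matchable0P S : star_matchable S 0 <->
  exists2 v, v \in S & matchable (S :\ v).
Proof.
split=> [[v [Z [vS _ _ /eqP]]]|[v vS mS]].
  by rewrite cards_eq0 => /eqP ->; rewrite setU0; exists v.
exists v, set0; split=> //; rewrite ?sub0set ?cards0 ?setU0 //.
by move=> z; rewrite inE.
Qed.

(** If the unmatched vertex is [x], the partner of [y] becomes the new unmatched vertex; otherwise
    [x] is matched with [y]. *)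
Lemma star_matchable0_pendant S x y : pendantP2 S x y ->
  star_matchable S 0 -> star_matchable (S :\: [set x; y]) 0.
Proof.
move=> pS /star_matchable0P[v vS [f mf]]; apply/star_matchable0P.
have [xS yS xy nx ny] := pendantP2_neighbors pS; have nxy := adj_neq xy.
have [vx|vx] := eqVneq v x.
  have yA : y \in S :\ v by rewrite !inE vx eq_sym nxy.
  have [fyA yfy _] := mf y yA; exists (f y).
    move: fyA; rewrite !inE vx negb_or => /andP[-> ->].
    by rewrite eq_sym adj_neq.
  exists f; have := matched_del mf yA; rewrite vx !setDDl.
  by rewrite setUA.
have xA : x \in S :\ v by rewrite !inE eq_sym vx.
have [fxA xfx _] := mf x xA.
have fxy : f x = y by apply: nx; move: fxA; rewrite inE => /andP[].
have vy : v != y by move: fxA; rewrite fxy !inE eq_sym => /andP[].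
exists v; first by rewrite !inE negb_or vx vy.
by exists f; have := matched_del mf xA; rewrite fxy !setDDl setUC.
Qed.

Lemma reduced_matchable S : reduces_to S ->
  matchable [set: T] <-> matchable S.
Proof. by elim=> // {}S x y _ -> /matchable_pendant. Qed.

(** The equivalence fails for the other [j]: K_2 with [j = 1] and P_3 with [j = 2] lose their star
    when reduced. *)
Lemma reduced_star j S : j = 0 \/ 2 < j -> reduces_to S ->
  star_matchable [set: T] j <-> star_matchable S j.
Proof.
move=> hj; elim=> // {}S x y _ -> pS; split; last exact: star_matchable_pendant_rev.
by case: hj => [->|j2]; [apply: star_matchable0_pendant | apply: star_matchable_pendant].
Qed.

Lemma star_matchable1 : star_matchable [set: T] 1 <-> matchable [set: T].
Proof.
split=> [[v [Z [_ _ vZ /eqP/cards1P[z eZ]]]]|[f mf]].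
  by rewrite eZ; apply: matchable_add; rewrite ?inE // vZ // eZ inE.
have [/card_gt0P[v _] _ _] := treeT; have vT := in_setT v.
have [_ vfv _] := mf v vT; exists v, [set f v]; split; rewrite ?subsetT ?cards1 //.
  by move=> z; rewrite inE => /eqP ->.
by exists f; apply: matched_del.
Qed.

Lemma star_matchable2 : star_matchable [set: T] 2 -> star_matchable [set: T] 0.
Proof.
move=> [v [Z [_ _ vZ /eqP/cards2P[a [b [ab eZ]]] mZ]]]; apply/star_matchable0P.
have va : adj v a by rewrite vZ // eZ !inE eqxx.
have vb : adj v b by rewrite vZ // eZ !inE eqxx orbT.
exists b; first by rewrite inE.
apply: (matchable_add va); rewrite ?inE ?andbT ?ab ?adj_neq //.
by rewrite setDDl setUC -setUA -eZ.
Qed.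

(** A neighbour [w] of the unmatched vertex becomes the centre, with that vertex and its own partner
    as leaves. This saves Dominator one move, which is impossible on a single vertex. *)
Lemma star_matchable0_2 : 1 < #|T| ->
  star_matchable [set: T] 0 -> star_matchable [set: T] 2.
Proof.
move=> T1 /star_matchable0P[v _ [f mf]]; have [_ cT _] := treeT.
have [w vw] : exists w, adj v w.
  have [z vz] : exists z, z != v.
    apply/existsP; apply: contraLR T1; rewrite negb_exists -leqNgt => /forallP H.
    by apply/card_le1_eqP => x y _ _; move/eqP: (negbNE (H x)) => ->;
       move/eqP: (negbNE (H y)) => ->.
  have /connectP[[|w p] /= ] := cT v z; first by move=> _ e; rewrite e eqxx in vz.
  by case/andP=> vw _ _; exists w.
have wA : w \in [set: T] :\ v by rewrite !inE eq_sym adj_neq.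
have [fwA wfw _] := mf w wA.
have vfw : f w != v by move: fwA; rewrite !inE andbT.
exists w, [set v; f w]; split; rewrite ?inE ?subsetT //.
- by move=> z; rewrite !inE => /orP[]/eqP -> //; rewrite adj_sym.
- by rewrite cards2 eq_sym vfw.
by exists f; have := matched_del mf wA; rewrite setDDl setUCA.
Qed.

(** In a tree the leaves are automatically independent, so this describes an induced [K_{1,j}]. *)
Definition is_star R j := exists v Z,
  [/\ R = v |: Z, {in Z, forall z, adj v z} & #|Z| = j].

(** A matched edge can serve as the core, so a nonempty [R] would be a single P_2, which is itself
    removable. *)
Lemma residual_matchable R : residual R -> matchable R -> R = set0.
Proof.
move=> resR [f mf]; have [//|[v vR]] := set_0Vmem R; have [_ pR] := resR.
have [fvR vfv _] := mf v vR.
suff eR : R = [set v; f v].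
  by have := pR v (f v); rewrite /pendantP2 vR fvR vfv {3}eR eqxx orbT.
apply: (residual_core (r := v) resR).
- by rewrite !inE eqxx.
- by apply/subsetP => u; rewrite !inE => /orP[]/eqP ->.
- move=> u; rewrite !inE => /orP[]/eqP -> ; first by rewrite eqxx.
  by have := adj_parent treeT v vfv; rewrite eqxx /= => /andP[_ /eqP->]; rewrite eqxx.
by exists f; apply: matched_del.
Qed.

Lemma residual_star R j : residual R -> star_matchable R j -> is_star R j.
Proof.
move=> resR [v [Z [vR ZR vZ cZ mZ]]]; exists v, Z; split=> //.
apply: (residual_core (r := v) resR _ _ _ mZ); first by rewrite !inE eqxx.
  by rewrite subUset sub1set vR.
move=> u; rewrite !inE => /orP[/eqP->|/vZ vu _]; first by rewrite eqxx.
case/orP: (adj_parent treeT v vu); first by rewrite eqxx.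
by case/andP=> _ /eqP ->; rewrite eqxx.
Qed.

Lemma is_star_matchable R j : is_star R j -> star_matchable R j.
Proof.
move=> [v [Z [-> vZ cZ]]]; exists v, Z; split=> //.
- by rewrite !inE eqxx.
- exact: subsetUr.
by rewrite setDv; apply: matchable0.
Qed.

Lemma is_star_card R j : is_star R j -> #|R| = j.+1.
Proof.
move=> [v [Z [-> vZ <-]]]; rewrite cardsU1.
suff -> : v \notin Z by [].
by apply/negP => /vZ; rewrite adj_irr.
Qed.

Lemma card1_is_star R : #|R| = 1 -> is_star R 0.
Proof.
move=> /eqP/cards1P[v ->]; exists v, set0; rewrite setU0 cards0; split=> //.
by move=> z; rewrite inE.
Qed.

Lemma iso_K1 R : iso (induced R) (complete 1) <-> #|R| = 1.
Proof.
have cR : #|induced R| = #|R| by rewrite /= card_sig.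
split=> [[f /bij_eq_card e _]|R1]; first by rewrite -cR e card_ord.
have eqR (u u' : induced R) : u = u'.
  have /card_le1_eqP H : #|induced R| <= 1 by rewrite cR R1.
  exact: H.
exists (fun=> ord0).
  by apply: inj_card_bij => [u u' _|]; [apply: eqR | rewrite cR R1 card_ord].
by move=> u u'; rewrite (eqR u u') !adj_irr.
Qed.

Lemma iso_star R j : iso (induced R) (complete_bipartite 1 j) <-> is_star R j.
Proof.
have cR : #|induced R| = #|R| by rewrite /= card_sig.
split=> [[f [g fK gK] adjf]|starR].
  pose v := val (g (inl ord0)); pose z i := val (g (inr i)).
  have z_inj : injective z.
    by move=> i i' /val_inj/(can_inj gK)[].
  exists v, [set z i | i in 'I_j]; split; last by rewrite card_imset // card_ord.
    apply/setP => u; rewrite !inE; apply/idP/orP => [uR|].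
      case e : (f (Sub u uR : induced R)) => [i|i].
        have i0 : i = ord0 by apply: ord1.
        by left; rewrite /v -i0 -e fK.
      by right; apply/imsetP; exists i; rewrite // /z -e fK.
    by case=> [/eqP->|/imsetP[i _ ->]]; apply: valP.
  by move=> _ /imsetP[i _ ->]; have := adjf (g (inl ord0)) (g (inr i)); rewrite !gK.
have cS := is_star_card starR; have [v [Z [eR vZ cZ]]] := starR.
have vR : v \in R by rewrite eR !inE eqxx.
have ZR z : z \in Z -> z \in R by rewrite eR !inE orbC => ->.
subst j; pose g (a : complete_bipartite 1 #|Z|) : induced R :=
  match a with
  | inl _ => Sub v vR
  | inr i => Sub (enum_val i) (ZR _ (enum_valP i))
  end.
have vz (i : 'I_#|Z|) : adj v (enum_val i) by apply/vZ/enum_valP.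
have vnZ (i : 'I_#|Z|) : v != enum_val i :> T := adj_neq (vz i).
have g_inj : injective g.
  move=> [i|i] [i'|i'] /(congr1 val) /=; first by rewrite (ord1 i) (ord1 i').
  - by move=> e; have := vnZ i'; rewrite -e eqxx.
  - by move=> e; have := vnZ i; rewrite e eqxx.
  by move/enum_val_inj->.
have [f gK fK] : bijective g.
  by apply: inj_card_bij g_inj _; rewrite cR cS /= card_sum !card_ord.
exists f; first by exists g.
move=> a b; rewrite -{2}(fK a) -{2}(fK b).
case: (f a) (f b) => [i|i] [i'|i']; rewrite /= /induced_rel /=.
- by rewrite adj_irr.
- by rewrite vz.
- by rewrite adj_sym vz.
(* With [v] as root every leaf has parent [v], whereas an edge between two leaves would make one the
   parent of the other. *)
apply/esym/negbTE/negP => zz'.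
have pz (i0 : 'I_#|Z|) : parent v (enum_val i0 : T) = v.
  have /(adj_parent treeT v) := vz i0.
  by rewrite eqxx /= => /andP[_ /eqP].
by case/orP: (adj_parent treeT v zz') => /andP[_]; rewrite pz; apply/negP/vnZ.
Qed.

End Residuals.

(** * Computing the game numbers *)

Section Numbers.
Local Open Scope ring_scope.

Lemma MB_number_eq (G : sgraph) b k : wins_within G b k ->
  (forall k', wins_within G b k' -> (k <= k')%N) -> MB_number G b = (k%:R)%:E%E.
Proof.
move=> wk min; rewrite /MB_number; case: pselect => [ex|[]]; last by exists k.
case: ex_minnP => m /asboolP wm minm; congr (_%:R)%:E%E.
by apply/eqP; rewrite eqn_leq min // minm //; apply/asboolP.
Qed.

Lemma MB_number_pinfty (G : sgraph) b : (forall k, ~ wins_within G b k) ->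
  MB_number G b = +oo%E.
Proof.
move=> none; rewrite /MB_number; case: pselect => // ex.
by exfalso; case: ex => k /none.
Qed.

Lemma half_natr (k : nat) (q : rat) : (k.*2)%:R = q -> k%:R = q / 2.
Proof. by move<-; rewrite -muln2 natrM mulfK. Qed.

End Numbers.

Local Open Scope ring_scope.

Theorem theorem4p5 (T : sgraph) (treeT : tree T) :
  (forall R : {set T}, residual R ->
    [/\ has_perfect_matching T ->
          gamma_MB T = (#|T|%:R / 2)%:E,
        (1 < #|T|)%N -> iso (induced R) (complete 1) ->
          gamma_MB T = ((#|T|%:R - 1) / 2)%:E,
        forall k : nat, (3 <= k)%N -> iso (induced R) (complete_bipartite 1 k) ->
          gamma_MB T = ((#|T|%:R - k%:R + 1) / 2)%:E
      & ~ has_perfect_matching T ->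
        ~ iso (induced R) (complete 1) ->
        ~ (exists2 k : nat, (3 <= k)%N & iso (induced R) (complete_bipartite 1 k)) ->
          gamma_MB T = +oo%E])
  /\
  ((has_perfect_matching T -> gamma_MB' T = (#|T|%:R / 2)%:E)
   /\ (~ has_perfect_matching T -> gamma_MB' T = +oo%E)).
Proof.
have [/card_gt0P[x0 _] _ _] := treeT.
split=> [R resR|]; last first.
  split=> /perfect_matchingP mT.
    have [m cT] := matchable_even mT; rewrite cardsT in cT.
    rewrite /gamma_MB' (@MB_number_eq _ _ m).
    - by rewrite -(half_natr (k := m) (q := #|T|%:R)) // cT.
    - by apply: sgame_upper; rewrite ?cT.
    move=> k /(sgame_lower treeT x0)[_].
    by rewrite cT leq_double.
  by apply: MB_number_pinfty => k /(sgame_lower treeT x0)[].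
have [redR _] := resR; rewrite /gamma_MB.
have matchR : matchable [set: T] -> R = set0.
  by move/(reduced_matchable redR)/(residual_matchable treeT resR).
have starR j : j = 0%N \/ (2 < j)%N -> star_matchable [set: T] j <-> is_star R j.
  move=> hj; rewrite (reduced_star hj redR).
  by split; [apply: (residual_star treeT) | apply: is_star_matchable].
have starR0 : star_matchable [set: T] 0 <-> #|R| = 1%N.
  rewrite (starR 0%N (or_introl erefl)).
  by split; [apply: is_star_card | apply: card1_is_star].
(* Each size of star with matchable complement pins down the shape of [R]. *)
have cases j : star_matchable [set: T] j ->
    [\/ j = 1%N /\ R = set0, (j <= 2)%N /\ #|R| = 1%N | (2 < j)%N /\ is_star R j].
  case: j => [/starR0|[|[|j]]]; first by constructor 2.
  - by move=> /(star_matchable1 treeT)/matchR; constructor 1.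
  - by move=> /star_matchable2/starR0; constructor 2.
  - by move=> sj; constructor 3; split=> //; apply/starR; first by right.
(* The largest available [j0] gives the fewest moves, by the bounds of [dgame_upper] and
   [dgame_lower]. *)
have value m j0 : star_matchable [set: T] j0 -> #|T|.+1 = (m.*2 + j0)%N ->
    (forall j, star_matchable [set: T] j -> (j <= j0)%N) ->
    MB_number T true = m%:R%:E%E.
  move=> s0 cT max; apply: MB_number_eq => [|k].
    by apply: dgame_upper s0 _; rewrite cT.
  case/(dgame_lower treeT) => j /max le; rewrite cT.
  by move=> /leq_trans/(_ (leq_add (leqnn _) le)); rewrite leq_add2r leq_double.
split.
- move=> /perfect_matchingP mT; have [m cT] := matchable_even mT.
  have R0 := matchR mT; rewrite cardsT in cT.
  rewrite (value m 1%N).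
  + by rewrite -(half_natr (k := m) (q := #|T|%:R)) // cT.
  + exact/(star_matchable1 treeT).
  + by rewrite cT addn1.
  by move=> j /cases[[->]|[]|[_ /is_star_card]] //; rewrite R0 cards0.
- move=> T1 /iso_K1 R1; have s0 := starR0.2 R1.
  have [v _ /matchable_even[m cv]] := (star_matchable0P _).1 s0.
  have cT : #|T| = m.*2.+1 by rewrite -cardsT (cardsD1 v) inE cv.
  (* The maximum is 2 rather than 0, by [star_matchable0_2]; this is where [T1] enters. *)
  rewrite (value m 2%N).
  + by rewrite -(half_natr (k := m) (q := #|T|%:R - 1)) // cT -natr1 addrK.
  + exact: star_matchable0_2.
  + by rewrite cT addn2.
  move=> j /cases[[_ R0]|[]|[j2 /is_star_card]] //; first by rewrite R0 cards0 in R1.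
  by rewrite R1 => -[ej]; rewrite -ej in j2.
- move=> k k2 /(iso_star treeT) starRk; have sk := (starR k (or_intror k2)).2 starRk.
  have [v [Z [_ _ vZ cZ /matchable_even[m]]]] := sk.
  rewrite (card_star_matchable vZ) cZ => cm.
  have leT : (k.+1 <= #|T|)%N by rewrite -(is_star_card starRk) max_card.
  have cT : #|T|.+1 = (m.+1.*2 + k)%N.
    by rewrite -(subnK leT) cm doubleS addnS !addSn.
  rewrite (value m.+1 k) //.
    rewrite -(half_natr (k := m.+1) (q := #|T|%:R - k%:R + 1)) //.
    by rewrite addrAC natr1 cT natrD addrK.
  (* Any star has at most two leaves, fewer than [k], or exactly [#|R| - 1], which is [k]. *)
  move=> j /cases[[-> _]|[j2 _]|[_ /is_star_card]].
  + by apply: leq_trans k2.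
  + by apply: leq_trans j2 (ltnW k2).
  by rewrite (is_star_card starRk) => -[->].
move=> NpM NK1 Nstar; apply: MB_number_pinfty => k /(dgame_lower treeT)[j /cases].
case=> [[_ R0] _|[_ /iso_K1//]|[j2 /(iso_star treeT) iR] _].
  apply/NpM/perfect_matchingP/(reduced_matchable redR).
  by rewrite R0; apply: matchable0.
by apply: Nstar; exists j.
Qed.
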